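(* Let $G$ be a finite group and let $n$ be a positive integer. If $L$ is a non-empty normal subset of $G$, then $|N_{n,L}|$ is a multiple of $\prod\limits_{i=1}^k\big[2^{(n, |C_G(L_i)|)}-1\big]^{|L_i|}$, where $\{L_1, L_2, \ldots, L_k\}$ is the partition of $L$ into conjugacy classes of $G$.
   Context: For a non-empty subset $S$ of a group $G$ and a positive integer $n$, put $\mho^{\{n\}}(S)=\{s^n \mid s\in S\}$. For a non-empty subset $L$ of $G$, $N_{n,L}$ denotes the set of all non-empty subsets $S\subseteq G$ such that $\mho^{\{n\}}(S)=L$. A subset $L$ of $G$ is normal if $g^{-1}Lg=L$ for all $g\in G$, i.e. $L$ is a union of conjugacy classes of $G$. For a subset $A$ of $G$, $C_G(A)=\{g\in G \mid ga=ag \text{ for all } a\in A\}$ is the centralizer of $A$ in $G$. For positive integers $a,b$, $(a,b)$ denotes their greatest common divisor. The number $0$ counts as a multiple of every integer. *)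

(* Defs.v *)
From mathcomp Require Import all_boot all_fingroup.

Set Implicit Arguments.
Unset Strict Implicit.
Unset Printing Implicit Defensive.

Local Open Scope group_scope.

Definition pow_set (gT : finGroupType) (n : nat) (S : {set gT}) : {set gT} :=
  [set s ^+ n | s in S].

Definition pow_preim (gT : finGroupType) (G : {group gT}) (n : nat)
    (L : {set gT}) : {set {set gT}} :=
  [set S : {set gT} | [&& S != set0, S \subset G & pow_set n S == L]].

Definition normal_subset (gT : finGroupType) (G : {group gT})
    (L : {set gT}) : Prop :=
  L \subset G /\ forall g, g \in G -> L :^ g = L.

Definition classes_in (gT : finGroupType) (G : {group gT}) (L : {set gT}) :
    {set {set gT}} :=
  [set x ^: G | x in L].

Lemma classes_in_partition (gT : finGroupType) (G : {group gT})
    (L : {set gT}) :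
  normal_subset G L ->
  partition (classes_in G L) L /\ classes_in G L \subset classes G.
Proof.
case=> sLG nLG.
have sub : classes_in G L \subset classes G by exact: imsetS.
split=> //; have /and3P[_ tiG nz] := classes_partition G.
apply/and3P; split.
- rewrite eqEsubset; apply/andP; split.
    apply/bigcupsP=> _ /imsetP[x Lx ->].
    by apply/subsetP=> _ /imsetP[g Gg ->]; rewrite -(nLG g Gg) memJ_conjg.
  apply/subsetP=> x Lx; apply/bigcupP; exists (x ^: G); last exact: class_refl.
  exact: imset_f.
- exact: trivIsetS sub tiG.
- by apply: contra nz; apply: (subsetP sub).
Qed.

(* Main.v *)
Require Import Defs.
From mathcomp Require Import all_boot all_fingroup.
From mathcomp Require Import cyclic pgroup center abelian frobenius.

(** A set [S] with [pow_set n S = L] amounts to a choice, for every [x] in [L],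
of a non-empty set of [n]-th roots of [x], so [#|pow_preim G n L|] is the
product over [L] of [2 ^ r x - 1], with [r x] the number of [n]-th roots of [x]
in [G]. It remains to see that [gcdn n #|'C_G[x]|] divides [r x]. All roots
of [x] centralise [x], so we may assume [x] central in [G]. Let [pi] be the set
of primes dividing [#[x]], and split a root [s] into its [pi]-part [y] and its
[pi^']-part [u].
- For fixed [y], the [u] are the solutions of [u ^+ n`_pi^' = 1] in ['C_G[y]],
  which Frobenius' theorem counts; summing over the class of [y] brings in the
  index of ['C_G[y]], whence the [pi^']-part of the divisibility.
- The order of [y] is [n`_pi * #[x]], and the coset of [s] modulo
  [<[y ^+ #[x]]>] consists of roots of [x]. These cosets, of size [n`_pi],
  partition the roots. *)

Set Implicit Arguments.
Unset Strict Implicit.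
Unset Printing Implicit Defensive.

Local Open Scope group_scope.

Section Roots.

Variable gT : finGroupType.
Implicit Types (G : {group gT}) (x y : gT) (D L S : {set gT}).

Definition roots G n x : {set gT} := [set s in G | s ^+ n == x].

(** The class of [y] has [#|G : 'C_G[y]|] elements and [F] is constant on it, so divisibility can be
    checked class by class. *)
Lemma dvdn_sum_classes G D (F : gT -> nat) d :
    normal_subset G D -> {in D & G, forall y g, F (y ^ g) = F y} ->
    {in D, forall y, d %| (#|G : 'C_G[y]| * F y)%N} ->
  d %| \sum_(y in D) F y.
Proof.
move=> nGD FJ dF; have [partD _] := classes_in_partition nGD.
rewrite (set_partition_big _ partD); apply: dvdn_sum => _ /imsetP[y Dy ->].
rewrite (eq_bigr (fun=> F y)) => [|_ /imsetP[g Gg ->]]; last exact: FJ.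
by rewrite sum_nat_const -index_cent1 dF.
Qed.

(** Since [x] is a [pi]-element, the [pi^']-part of a root has trivial [n]-th power, so its order
    divides the [pi^']-part of [n]; it centralises [y] because both are powers of the same root. *)
Lemma roots_constt_fibre G n (pi : nat_pred) x y :
    0 < n -> y \in G -> y ^+ n = x -> pi.-elt y ->
  [set s in roots G n x | s.`_pi == y]
    = y *: 'Ldiv_(gcdn n`_pi^' #|'C_G[y]|)('C_G[y]).
Proof.
move=> n_gt0 Gy ynx pi_y.
have pi_x : pi.-elt x by rewrite -ynx p_eltX.
apply/setP=> s; rewrite mem_lcoset [LHS]inE inE; apply/idP/idP.
  case/andP=> /andP[Gs /eqP snx] /eqP sy.
  have -> : y^-1 * s = s.`_pi^' by rewrite -sy -{2}(consttC pi s) mulKg.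
  have Cs : s.`_pi^' \in 'C_G[y].
    rewrite inE groupX //= -sy; apply/cent1P.
    exact: commuteX2.
  rewrite inE Cs inE -order_dvdn dvdn_gcd order_dvdG // andbT.
  have: #[s.`_pi^'] %| n.
    rewrite order_dvdn -consttX snx; apply/eqP/constt1P.
    by rewrite /p_elt (eq_pnat _ (negnK pi)).
  rewrite -{1}(partnC pi n_gt0) Gauss_dvdr // coprime_sym.
  exact: pnat_coprime (part_pnat _ _) (p_elt_constt _ _).
set u := y^-1 * s; have -> : s = y * u by rewrite mulKVg.
case/setIP=> /setIP[Gu /cent1P/commute_sym cyu].
rewrite inE -order_dvdn dvdn_gcd => /andP[um _]; rewrite groupM //=.
have pi'u : pi^'.-elt u by apply: pnat_dvd um (part_pnat _ _).
have un : u ^+ n = 1.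
  by apply/eqP; rewrite -order_dvdn; apply: dvdn_trans um (dvdn_part _ _).
rewrite expgMn // un ynx mulg1 eqxx consttM // (constt_p_elt pi_y).
by rewrite (constt1P pi'u) mulg1 eqxx.
Qed.

Lemma dvdn_card_roots_pi' G n x (pi := \pi(#[x]) : nat_pred) :
  0 < n -> x \in 'Z(G) -> gcdn n`_pi^' #|G| %| #|roots G n x|.
Proof.
move=> n_gt0 /centerP[Gx cGx].
have pi_x : pi.-elt x by apply: pnat_pi.
pose D := [set y in G | pi.-elt y && (y ^+ n == x)].
pose fibre y := [set s in roots G n x | s.`_pi == y].
have -> : #|roots G n x| = (\sum_(y in D) #|fibre y|)%N.
  rewrite -sum1_card (partition_big (fun s => s.`_pi) [in D]) => [|s] /=.
    by apply: eq_bigr => y _; rewrite sum1dep_card.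
  rewrite !inE => /andP[Gs /eqP snx].
  by rewrite groupX // p_elt_constt -consttX snx constt_p_elt //=.
(* As [x] is central, conjugation permutes its roots; hence [D] is normal and conjugate fibres have
   equal size. *)
have rootsJ s g : g \in G -> (s ^ g \in roots G n x) = (s \in roots G n x).
  move=> Gg; rewrite !inE groupJr // -conjXg -{1}(mulKg g x) -cGx //.
  by rewrite -conjgE (inj_eq (@conjg_inj _ g)).
apply: (@dvdn_sum_classes G).
- split; first by apply/subsetP=> y; rewrite inE => /andP[].
  move=> g Gg; apply/setP=> y; rewrite mem_conjg.
  have := rootsJ y _ (groupVr Gg); rewrite !inE /p_elt orderJ.
  by rewrite andbCA => ->; rewrite andbCA.
- move=> y g _ Gg; rewrite -[RHS](cardJg _ g).
  apply: eq_card => s; rewrite mem_conjg [LHS]inE [RHS]inE rootsJ ?groupV //.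
  by rewrite consttJ (can2_eq (conjgKV g) (conjgK g)).
move=> y; rewrite inE => /and3P[Gy pi_y /eqP ynx].
rewrite /fibre roots_constt_fibre // card_lcoset.
(* Let m be the [pi^']-part of [n]. Frobenius gives the factor gcd(m, |C_G(y)|); times the index of
   C_G(y) it is gcd(m |G : C_G(y)|, |G|), a multiple of gcd(m, |G|). *)
have dF := Frobenius_Ldiv (dvdn_gcdr n`_pi^' #|'C_G[y]|).
apply: dvdn_trans (dvdn_mul (dvdnn #|G : 'C_G[y]|) dF).
rewrite muln_gcdr dvdn_gcd.
by rewrite dvdn_mull ?dvdn_gcdl // mulnC Lagrange ?subsetIl // dvdn_gcdr.
Qed.

Lemma order_root n y (pi := \pi(#[y ^+ n]) : nat_pred) :
  0 < n -> pi.-elt y -> #[y] = (n`_pi * #[y ^+ n])%N.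
Proof.
move=> n_gt0 pi_y; suffices gcdE : gcdn #[y] n = (n`_pi)%N.
  by rewrite orderXgcd -gcdE mulnC divnK ?dvdn_gcdl.
apply/eqP; rewrite eqn_dvd dvdn_gcd dvdn_part andbT; apply/andP; split.
  rewrite -{1}(partnC pi n_gt0) Gauss_gcdl ?dvdn_gcdr //.
  exact: pnat_coprime pi_y (part_pnat _ _).
apply/dvdn_partP=> // p p_npi.
have pi_p : p \in pi.
  by move: p_npi; rewrite pi_of_part // inE => /andP[].
have p_pr : prime p by move: pi_p; rewrite mem_primes => /andP[].
rewrite partn_part => [|q /eqP-> //].
apply: dvdn_trans (dvdn_part p _); rewrite !p_part dvdn_exp2l //.
(* If [p] divided [#[y]] to a lower power than [n], the [n]-th power would kill the [p]-part of [y],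
   and [p] could not divide the order of [y ^+ n]. *)
rewrite leqNgt; apply/negP=> lt_yn.
have: (y ^+ n).`_p = 1.
  rewrite consttX; apply/eqP; rewrite -order_dvdn order_constt p_part.
  by apply: dvdn_trans (dvdn_exp2l p (ltnW lt_yn)) _; rewrite -p_part dvdn_part.
move/constt1P; rewrite /p_elt p'natE // => /negP[].
by move: pi_p; rewrite mem_primes => /and3P[].
Qed.

Lemma dvdn_card_roots_pi G n x (pi := \pi(#[x]) : nat_pred) :
  0 < n -> (n`_pi)%N %| #|roots G n x|.
Proof.
move=> n_gt0; have pi_x : pi.-elt x by apply: pnat_pi.
(* For a root [s] with [pi]-part y, [y ^+ n = x]; so elements of [Z s] have trivial [n]-th power and
   commute with [s], and [f s] consists of roots. *)
pose Z (s : gT) := <[s.`_pi ^+ #[x]]>; pose f s := s *: Z s.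
have root_pi s : s \in roots G n x -> s.`_pi ^+ n = x.
  by rewrite inE => /andP[_ /eqP snx]; rewrite -consttX snx constt_p_elt.
have order_pi s : s \in roots G n x -> #[s.`_pi] = (n`_pi * #[x])%N.
  move/root_pi=> snx; rewrite (order_root n_gt0) ?snx //.
  exact: p_elt_constt.
rewrite -sum1_card (partition_big_imset f) /=.
apply: dvdn_sum => _ /imsetP[s Rs ->]; rewrite sum1dep_card.
suffices -> : [set t in roots G n x | f t == f s] = f s.
  rewrite card_lcoset -orderE orderXgcd order_pi //.
  by rewrite (gcdn_idPr _) ?dvdn_mull // mulnK ?order_gt0.
apply/setP=> t; rewrite inE; apply/andP/idP=> [[_ /eqP<-]|].
  exact: lcoset_refl.
case/lcosetP=> z Zz ->; have /cycleP[k zE] := Zz; rewrite -expgM in zE.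
have csz : commute s z by rewrite zE; apply/commuteX/commuteX.
have szpi : (s * z).`_pi = s.`_pi ^+ (1 + #[x] * k).
  by rewrite consttM // expgD zE (constt_p_elt (p_eltX _ (p_elt_constt _ _))).
have /andP[Gs /eqP snx] : (s \in G) && (s ^+ n == x) by rewrite inE in Rs.
split.
  rewrite inE groupM ?zE ?groupX //= -zE expgMn // snx zE -expgM mulnC.
  by rewrite expgM root_pi // expgM expg_order expg1n mulg1.
(* Passing to [s * z] raises the [pi]-part of [s] to the power [1 + #[x] * k]. This exponent is
   prime to [#[x]], hence a [pi^']-number, so the same cyclic group is generated. *)
suffices ZE : Z (s * z) = Z s by rewrite /f ZE lcosetM lcoset_id.
rewrite /Z szpi -expgM mulnC expgM; apply/esym/eqP.
rewrite -[_ == _]/(generator _ _) generator_coprime.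
have pi'm : pi^'.-nat (1 + #[x] * k).
  by rewrite -coprime_pi' // -coprime_modr mulnC addnC modnMDl coprime_modr coprimen1.
exact: pnat_coprime (p_eltX _ (p_elt_constt _ _)) pi'm.
Qed.

Lemma dvdn_card_roots_center G n x :
  0 < n -> x \in 'Z(G) -> gcdn n #|G| %| #|roots G n x|.
Proof.
move=> n_gt0 Zx; pose pi : nat_pred := \pi(#[x]).
rewrite -(partnC pi (n := gcdn n #|G|)) ?gcdn_gt0 ?n_gt0 //.
rewrite Gauss_dvd ?coprime_partC // !partn_gcd // (dvdn_trans (dvdn_gcdl _ _)).
  apply: dvdn_trans (dvdn_card_roots_pi' n_gt0 Zx).
  by rewrite dvdn_gcd dvdn_gcdl (dvdn_trans (dvdn_gcdr _ _)) ?dvdn_part.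
exact: dvdn_card_roots_pi.
Qed.

Lemma dvdn_card_roots G n x :
  0 < n -> x \in G -> gcdn n #|'C_G[x]| %| #|roots G n x|.
Proof.
move=> n_gt0 Gx; have -> : roots G n x = roots 'C_G[x] n x.
  apply/setP=> s; rewrite [LHS]inE [RHS]inE in_setI.
  case: eqP => [<-|]; rewrite ?andbF // cent1C.
  by rewrite (groupX _ (cent1id s)) !andbT.
apply: dvdn_card_roots_center => //; apply/centerP; rewrite inE Gx cent1id.
by split=> // y /setIP[_ /cent1P].
Qed.

Lemma card_pow_preim G n L : L != set0 ->
  #|pow_preim G n L| = (\prod_(x in L) (2 ^ #|roots G n x|).-1)%N.
Proof.
move=> L_neq0; pose F x := powerset (roots G n x) :\ set0.
have cardF x : #|F x| = (2 ^ #|roots G n x|).-1.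
  by rewrite -card_powerset (cardsD1 set0 (powerset _)) powersetE sub0set.
have -> : (\prod_(x in L) (2 ^ #|roots G n x|).-1)%N = #|pfamily set0 [in L] F|.
  rewrite card_pfamily foldrE big_map big_enum /=.
  by apply: eq_bigr => x _; rewrite -cardF.
(* [f] cuts [S] into the fibres of the power map, and their union recovers [S]. Outside [L] the
   value is the default [set0] of [pfamily]. *)
pose f S : {ffun gT -> {set gT}} :=
  [ffun x => if x \in L then S :&: roots G n x else set0].
have f_inj : {in pow_preim G n L &, injective f}.
  suffices fK : {in pow_preim G n L, cancel f (fun g => \bigcup_x g x)}.
    exact: can_in_inj fK.
  move=> S; rewrite inE => /and3P[_ sSG /eqP SL]; apply/setP=> s.
  apply/bigcupP/idP=> [[x _]|Ss].
    by rewrite ffunE; case: ifP => _; rewrite inE // => /andP[].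
  exists (s ^+ n) => //; rewrite ffunE -SL (imset_f (fun s => s ^+ n) Ss).
  by rewrite !inE Ss (subsetP sSG) /=.
rewrite -(card_in_imset f_inj); apply: eq_card => g.
apply/imsetP/pfamilyP=> [[S]|[/supportP g0 gF]].
  rewrite inE => /and3P[_ sSG /eqP SL] ->; split.
    by apply/supportP=> x /negPf; rewrite ffunE /= => ->.
  move=> x /= Lx; rewrite ffunE Lx !inE subsetIr andbT.
  move: Lx; rewrite -SL => /imsetP[s Ss ->]; apply/set0Pn; exists s.
  by rewrite !inE Ss (subsetP sSG) /=.
have {}gF x : x \in L -> g x != set0 /\ g x \subset roots G n x.
  by move/gF; rewrite !inE => /andP.
have mem_g x s : s \in g x -> [/\ x \in L, s \in G & s ^+ n = x].
  have [Lx | /g0->] := boolP (x \in L); last by rewrite inE.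
  by move/(subsetP (gF x Lx).2); rewrite inE => /andP[Gs /eqP].
(* Every [x] in [L] is attained because [g x] is non-empty, which is why [F] omits [set0]. *)
have SL : pow_set n (\bigcup_x g x) = L.
  apply/setP=> x; apply/imsetP/idP=> [[s /bigcupP[y _ gs] ->] | Lx].
    by have [Ly _ ->] := mem_g y s gs.
  have /set0Pn[s gs] := (gF x Lx).1; exists s; last by have [] := mem_g x s gs.
  by apply/bigcupP; exists x.
exists (\bigcup_x g x).
  rewrite inE SL eqxx andbT; apply/andP; split.
    by apply: contra_neq L_neq0 => S0; rewrite -SL S0 /pow_set imset0.
  by apply/bigcupsP=> x _; apply/subsetP=> s /mem_g[].
apply/ffunP=> x; rewrite ffunE; case: ifPn => [Lx|/g0-> //].
apply/setP=> s; apply/idP/setIP=> [gs|[/bigcupP[y _ gs]]].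
  by split; [apply/bigcupP; exists x | apply: subsetP (gF x Lx).2 s gs].
by rewrite inE => /andP[_ /eqP<-]; have [_ _ ->] := mem_g y s gs.
Qed.

End Roots.

Theorem corollary2p4 (gT : finGroupType) (G : {group gT}) (n : nat)
    (L : {set gT}) (n_gt0 : 0 < n) (L_neq0 : L != set0)
    (L_normal : normal_subset G L) :
  \prod_(C in classes_in G L) (2 ^ gcdn n #|('C_G(C))%g| - 1) ^ #|C|
    %| #|pow_preim G n L|.
Proof.
have [partL _] := classes_in_partition L_normal.
rewrite card_pow_preim // (set_partition_big _ partL).
apply: (big_ind2 (fun a b => a %| b)) => [//||C].
  by move=> *; apply: dvdn_mul.
case/imsetP=> x Lx ->; rewrite -prod_nat_const.
apply: (big_ind2 (fun a b => a %| b)) => [//||y xGy].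
  by move=> *; apply: dvdn_mul.
have Gy : y \in G.
  by move: (subsetP L_normal.1 x Lx) xGy => Gx /imsetP[g Gg ->]; rewrite groupJ.
(* The centraliser of the whole class lies in that of its member [y], so its order divides
   [#|'C_G[y]|]. *)
have sC : 'C_G(x ^: G) \subset 'C_G[y].
  by rewrite -cent_set1 setIS // centS // sub1set.
have /dvdnP[q ->] : gcdn n #|'C_G(x ^: G)| %| #|roots G n y|.
  apply: dvdn_trans (dvdn_card_roots n_gt0 Gy).
  rewrite dvdn_gcd dvdn_gcdl (dvdn_trans (dvdn_gcdr _ _)) //.
  exact: cardSg sC.
(* With d the gcd, [2 ^ d - 1] divides [2 ^ (d * q) - 1]. *)
by rewrite subn1 mulnC expnM dvdn_pred_predX.
Qed.
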